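(* Let $E$ be an $n$-dimensional vector space over a field $\mathbb{F}$ and let $\tilde{\mathcal{B}}\subseteq\mathcal{L}(E)$ be a collection of subspaces satisfying the axioms (B1), (B2) and (nB3). Then $(E,\tilde{\mathcal{B}})$ is a $q$-matroid, i.e. $\tilde{\mathcal{B}}$ satisfies (B1), (B2), (B3) and (B4).
   Context: $n$ is a positive integer, $\mathbb{F}$ is an arbitrary field, and $\mathcal{L}(E)$ denotes the lattice of all subspaces of $E$. For a family $\mathcal{A}\subseteq\mathcal{L}(E)$ and $X\in\mathcal{L}(E)$, $\max(X,\mathcal{A})$ is the set of members of $\mathcal{A}$ contained in $X$ that have the largest dimension among all members of $\mathcal{A}$ contained in $X$, and $X\cap\mathcal{A}:=\{X\cap A: A\in\mathcal{A}\}$. (So $\max(E,A\cap\mathcal{B})$ is the set of intersections $A\cap B$, $B\in\mathcal{B}$, of maximal dimension.) Axioms for $\mathcal{B}\subseteq\mathcal{L}(E)$: (B1) $\mathcal{B}\neq\emptyset$. (B2) For all $B_1,B_2\in\mathcal{B}$, if $B_1\subseteq B_2$, then $B_1=B_2$. (B3) For all $B_1,B_2\in\mathcal{B}$ and for every subspace $A$ of codimension $1$ in $B_1$ satisfying $B_1\cap B_2\subseteq A$, there is a $1$-dimensional subspace $y$ of $B_2$ such that $A+y\in\mathcal{B}$. (B4) For all $A,B\in\mathcal{L}(E)$ and $I,J\in\mathcal{L}(E)$ such that $I\in\max(E,A\cap\mathcal{B})$ and $J\in\max(E,B\cap\mathcal{B})$, there exists $K\in\max(E,(A+B)\cap\mathcal{B})$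 such that $K\subseteq I+J$. (nB3) For all $B_1,B_2\in\mathcal{B}$, and for each subspace $A$ that has codimension $1$ in $B_1$, there exists $X\subseteq E$ of codimension $1$ in $E$ such that $X\supseteq A$, $X\not\supseteq B_2$ and $A+x\in\mathcal{B}$ for all $1$-dimensional $x\subseteq E$, $x\not\subseteq X$. A $q$-matroid given by a family $\mathcal{B}$ of bases is a pair $(E,\mathcal{B})$ such that $\mathcal{B}$ satisfies (B1)-(B4). *)

(* Defs.v *)
From mathcomp Require Import all_boot all_algebra.
From mathcomp Require Import classical_sets.

Set Implicit Arguments.
Unset Strict Implicit.
Unset Printing Implicit Defensive.

Local Open Scope classical_set_scope.

Section QMatroid.
Variables (F : fieldType) (E : vectType F).
Implicit Types (X Y A I J K : {vspace E}) (B : set {vspace E}).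

Definition codim1 A X : Prop := (A <= X)%VS /\ \dim X = (\dim A).+1.

Definition max_in X B : set {vspace E} :=
  [set Y | [/\ B Y, (Y <= X)%VS
             & forall Z : {vspace E}, B Z -> (Z <= X)%VS -> \dim Z <= \dim Y]].

Definition cap_family X B : set {vspace E} := [set (X :&: A)%VS | A in B].

Definition axiom_B1 B : Prop := B !=set0.

Definition axiom_B2 B : Prop :=
  forall B1 B2 : {vspace E}, B B1 -> B B2 -> (B1 <= B2)%VS -> B1 = B2.

Definition axiom_B3 B : Prop :=
  forall B1 B2 : {vspace E}, B B1 -> B B2 ->
  forall A, codim1 A B1 -> (B1 :&: B2 <= A)%VS ->
  exists y : {vspace E}, [/\ (y <= B2)%VS, \dim y = 1%N & B (A + y)%VS].

Definition axiom_B4 B : Prop :=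
  forall A A' I J,
    max_in fullv (cap_family A B) I -> max_in fullv (cap_family A' B) J ->
  exists2 K, max_in fullv (cap_family (A + A')%VS B) K & (K <= I + J)%VS.

Definition axiom_nB3 B : Prop :=
  forall B1 B2 : {vspace E}, B B1 -> B B2 ->
  forall A, codim1 A B1 ->
  exists X, [/\ codim1 X fullv, (A <= X)%VS, ~~ (B2 <= X)%VS
    & forall x : {vspace E}, \dim x = 1%N -> ~~ (x <= X)%VS -> B (A + x)%VS].

Definition is_qmatroid B : Prop :=
  [/\ axiom_B1 B, axiom_B2 B, axiom_B3 B & axiom_B4 B].

End QMatroid.

(* Main.v *)
Require Import Defs.
From mathcomp Require Import all_boot all_algebra.
From mathcomp Require Import boolp classical_sets.

Set Implicit Arguments.
Unset Strict Implicit.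
Unset Printing Implicit Defensive.

(** Call a subspace independent if it lies in a member of the family [B].

    (nB3) says that a hyperplane [A] of a basis is completed to a basis by every
    vector outside some subspace [X] which does not contain a second prescribed
    basis; the one form of it used below ([exchange]) keeps exactly this.  A
    vector of the second basis outside [X] gives (B3) at once, and the usual
    exchange argument then shows that all bases have the same dimension
    ([bases_dim]).

    The heart of the proof is that the exchange property passes from the
    independent spaces of dimension [k + 1] to those of dimension [k]
    ([exchange_truncation]), hence holds in every dimension.  This yields an
    augmentation property ([indep_augment]): if [I] and [J] are independent and
    [I] has smaller dimension, then some [X] containing [I] but not [J] is such
    that every vector outside [X] extends [I] to an independent space.

    For (B4), let [I] and [J] be largest independent subspaces of [A] and [A'],
    and extend them to largest independent subspaces [K] and [K'] of [I + J].
    Suppose that [K] is not largest in [A + A'], and let [X] be given by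
    augmentation.  By maximality of [K] the space [I + J] lies in [X], while
    [A + A'] does not, so there is a vector [v] of [A] or of [A'] outside [X],
    and [K + <[v]>] is independent.  If [v] is in [A], then [I + <[v]>] is an
    independent subspace of [A], too large.  If [v] is in [A'], augmenting [K']
    from the larger space [K + <[v]>] shows that [K' + <[v]>] is independent,
    because the new subspace [X'] must contain [I + J] and so must avoid [v];
    then [J + <[v]>] is too large in [A']. *)

(** * Lines and intermediate subspaces *)

Section Subspaces.
Variables (F : fieldType) (E : vectType F).
Implicit Types (A I J K U X : {vspace E}) (v : E).

Lemma dim_add_line U v : v \notin U -> \dim (U + <[v]>)%VS = (\dim U).+1.
Proof.
move=> vNU; rewrite dimv_disjoint_sum.
  by rewrite dim_vline; case: eqVneq vNU => [->|_ _]; rewrite ?mem0v ?addn1.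
apply/eqP; rewrite -subv0; apply/subvP => w /memv_capP[wU /vlineP[c wE]].
rewrite memv0 wE; have [->|c0] := eqVneq c 0%R; first by rewrite GRing.scale0r.
by move: wU; rewrite wE GRing.rpredZeq (negPf c0) (negPf vNU).
Qed.

Lemma subspace_between A U k : (A <= U)%VS -> \dim A <= k <= \dim U ->
  exists K, [/\ (A <= K)%VS, (K <= U)%VS & \dim K = k].
Proof.
move=> AU; elim: k => [|k IHk] /andP[Ak kU].
  by exists A; split; rewrite ?subvv //; apply/eqP; rewrite -leqn0.
move: Ak; rewrite leq_eqVlt => /orP[/eqP dimA | Ak].
  by exists A; split; rewrite ?subvv.
have [|K [AK KU dimK]] := IHk; first by rewrite -ltnS Ak ltnW.
have /subvPn[v vU vNK] : ~~ (U <= K)%VS.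
  by apply/negP => /dimvS; rewrite dimK leqNgt kU.
exists (K + <[v]>)%VS; split; last by rewrite dim_add_line ?dimK.
  exact: subv_trans AK (addvSl _ _).
by rewrite subv_add KU -memvE.
Qed.

End Subspaces.

(** * The exchange property *)

Section Exchange.
Variables (F : fieldType) (E : vectType F).
Implicit Types (A X : {vspace E}) (v : E) (C : set {vspace E}).

(** The form in which (nB3) is carried from a family to its truncations: lines
    are replaced by spanning vectors, and [X] may be any subspace, so that only
    its position relative to [A] and [C2] has to be followed. *)
Definition exchange C := forall (C1 C2 : {vspace E}) A, C C1 -> C C2 -> codim1 A C1 ->
  exists X, [/\ (A <= X)%VS, ~~ (C2 <= X)%VS
              & forall v, v \notin X -> C (A + <[v]>)%VS].

Lemma axiom_nB3_exchange C : axiom_nB3 C -> exchange C.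
Proof.
move=> nB3 C1 C2 A CC1 CC2 A1; have [X [_ AX C2X hX]] := nB3 _ _ CC1 CC2 _ A1.
exists X; split=> // v vX; apply: hX; last by rewrite -memvE.
by rewrite dim_vline; case: eqVneq vX => // ->; rewrite mem0v.
Qed.

Lemma exchange_axiom_B3 C : exchange C -> axiom_B3 C.
Proof.
move=> exC C1 C2 CC1 CC2 A A1 _.
have [X [_ /subvPn[v vC2 vX] hX]] := exC _ _ _ CC1 CC2 A1.
exists <[v]>%VS; split; [by rewrite -memvE | | exact: hX].
by rewrite dim_vline; case: eqVneq vX => // ->; rewrite mem0v.
Qed.

(** Exchanging into [C2] a hyperplane of [C1] that contains [C1 :&: C2] keeps
    the dimension and enlarges the intersection with [C2], until the basis
    reached lies in [C2]. *)
Lemma bases_dim C : axiom_B2 C -> exchange C ->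
  forall C1 C2 : {vspace E}, C C1 -> C C2 -> \dim C1 = \dim C2.
Proof.
move=> antiC exC C1 C2 + CC2.
have [m] := ubnP (\dim C1 - \dim (C1 :&: C2)).
elim: m C1 => // m IHm C1 ltm CC1.
have [C12|C12] := boolP (C1 <= C2)%VS; first by rewrite (antiC _ _ CC1 CC2).
have ltI : \dim (C1 :&: C2) < \dim C1.
  rewrite ltnNge; apply: contra C12 => le.
  have /eqP <- : (C1 :&: C2)%VS == C1 by rewrite eqEdim capvSl.
  exact: capvSr.
have [|A [IA AC1 dimA]] := @subspace_between _ _ _ _ (\dim C1).-1 (capvSl C1 C2).
  by rewrite leq_pred andbT; case: (\dim C1) ltI.
have dimC1 : \dim C1 = (\dim A).+1 by rewrite dimA prednK //; case: (\dim C1) ltI.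
have [X [AX /subvPn[v vC2 vX] hX]] := exC _ _ _ CC1 CC2 (conj AC1 dimC1).
have vA : v \notin A by apply: contra vX; apply: subvP.
rewrite dimC1 -(dim_add_line vA); apply: IHm (hX v vX).
rewrite dim_add_line // -dimC1.
have le : (C1 :&: C2 + <[v]> <= (A + <[v]>) :&: C2)%VS.
  by rewrite subv_cap addvS //= subv_add capvSr -memvE.
have vI : v \notin (C1 :&: C2)%VS by apply: contra vA; apply: subvP.
have := dimvS le; rewrite dim_add_line // => ltI'.
by rewrite -ltnS; apply: leq_trans ltm; rewrite ltnS ltn_sub2l.
Qed.

End Exchange.

(** * Independent subspaces *)

Section Independence.
Variables (F : fieldType) (E : vectType F) (B : set {vspace E}).
Implicit Types (A I J K L S X : {vspace E}) (v : E).

Definition indep I := exists2 B0, B B0 & (I <= B0)%VS.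

Definition indep_dim (k : nat) : set {vspace E} := [set I | indep I /\ \dim I = k]%classic.

Lemma indepS I J : (I <= J)%VS -> indep J -> indep I.
Proof. by move=> IJ [B0 BB0 JB0]; exists B0 => //; apply: subv_trans JB0. Qed.

(** Extend [I] and [J] to spaces [I'] and [J'] of dimension [k + 1], and compare
    [I] with [J'].  The subspace [X] so obtained is good for [A] as well unless
    it contains [J].  In that case it misses some [z] of [J'], which makes
    [I + <[z]>] independent; comparing its hyperplane [A + <[z]>] with
    [J' = J + <[z]>] gives a subspace that contains [z], hence not [J]. *)
Lemma exchange_truncation (k : nat) :
    (forall I, indep_dim k I -> exists2 I', indep_dim k.+1 I' & (I <= I')%VS) ->
  exchange (indep_dim k.+1) -> exchange (indep_dim k).
Proof.
move=> ext exB I J A Ik Jk [AI dimI].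
have [I' I'k II'] := ext _ Ik; have [J' J'k JJ'] := ext _ Jk.
have [dIk dJk dJ'k] : [/\ \dim I = k, \dim J = k & \dim J' = k.+1].
  by case: Ik => _ ->; case: Jk => _ ->; case: J'k => _ ->.
have I1 : codim1 I I' by split=> //; case: I'k => _ ->; rewrite dIk.
have [X [IX J'X hX]] := exB _ _ _ I'k J'k I1.
have AX : (A <= X)%VS by apply: subv_trans IX.
have [JX|JX] := boolP (J <= X)%VS; last first.
  exists X; split=> // v vX; split; last first.
    by rewrite dim_add_line ?(contra (subvP AX v)) // -dimI.
  by have [iI _] := hX v vX; apply: indepS iI; apply: addvS.
have /subvPn[z zJ' zX] := J'X.
have zA : z \notin A by apply: contra zX; apply: subvP.
have Az1 : codim1 (A + <[z]>)%VS (I + <[z]>)%VS.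
  split; first exact: addvS.
  by rewrite !dim_add_line ?(contra (subvP IX z)) // dimI.
have [Y [AzY J'Y hY]] := exB _ _ _ (hX z zX) J'k Az1.
have AY : (A <= Y)%VS by apply: subv_trans AzY; apply: addvSl.
exists Y; split=> // [|v vY].
  apply: contra J'Y => JY.
  have <- : (J + <[z]>)%VS = J'.
    apply/eqP; rewrite eqEdim subv_add JJ' -memvE zJ' /=.
    by rewrite dim_add_line ?(contra (subvP JX z)) // dJk dJ'k.
  by rewrite subv_add JY; apply: subv_trans AzY; apply: addvSr.
split; last by rewrite dim_add_line ?(contra (subvP AY v)) // -dimI.
by have [iY _] := hY v vY; apply: indepS iY; rewrite addvS ?addvSl.
Qed.

Hypotheses (antiB : axiom_B2 B) (exB : exchange B).

(** Descending induction on [k]: the independent spaces of largest dimension are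
    the members of [B], and every smaller one extends by one dimension. *)
Lemma exchange_indep_dim (k : nat) : exchange (indep_dim k).
Proof.
move=> I0 J0 A0 Ik; have [[B0 BB0 IB0] dimI0] := Ik.
have kB0 : k <= \dim B0 by rewrite -dimI0 dimvS.
suff exk : exchange (indep_dim k) by apply: exk Ik.
move=> {I0 J0 A0 Ik IB0 dimI0}.
have [m] := ubnP (\dim B0 - k); elim: m k kB0 => // m IHm k kB0 ltm.
have dimB B1 : B B1 -> \dim B1 = \dim B0 by move=> BB1; apply: (bases_dim antiB).
move: kB0; rewrite leq_eqVlt => /orP[/eqP kE|kB0].
  suff -> : indep_dim k = B by [].
  apply/predeqP => I; split=> [[[B1 BB1 IB1] dimI]|BI]; last first.
    by split; [exists I | rewrite kE dimB].
  suff /eqP-> : I == B1 by [].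
  by rewrite eqEdim IB1 dimI kE (dimB _ BB1) /=.
apply: exchange_truncation => [I [[B1 BB1 IB1] dimI]|].
  have [|K [IK KB1 dimK]] := @subspace_between _ _ _ _ k.+1 IB1.
    by rewrite dimI leqnSn dimB.
  by exists K => //; split=> //; exists B1.
apply: IHm => //; rewrite -ltnS; apply: leq_trans ltm.
by rewrite ltnS ltn_sub2l.
Qed.

(** Exchange in dimension [\dim I + 1], where [I] becomes a hyperplane of an
    independent space and [J] can be cut down to the same dimension. *)
Lemma indep_augment I J : indep I -> indep J -> \dim I < \dim J ->
  exists X, [/\ (I <= X)%VS, ~~ (J <= X)%VS
              & forall v, v \notin X -> indep (I + <[v]>)%VS].
Proof.
move=> [B1 BB1 IB1] iJ ltIJ; have [B2 BB2 JB2] := iJ.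
have dimB : \dim J <= \dim B1.
  by rewrite (bases_dim antiB exB BB1 BB2) dimvS.
have [|I' [II' I'B1 dimI']] := @subspace_between _ _ _ _ (\dim I).+1 IB1.
  by rewrite leqnSn (leq_trans ltIJ).
have [|J' [_ J'J dimJ']] := @subspace_between _ _ _ _ (\dim I).+1 (sub0v J).
  by rewrite dimv0.
have I'k : indep_dim (\dim I).+1 I' by split=> //; exists B1.
have J'k : indep_dim (\dim I).+1 J' by split=> //; apply: indepS iJ.
have [X [IX J'X hX]] := exchange_indep_dim I'k J'k (conj II' dimI').
exists X; split=> // [|v /hX[]//].
by apply: contra J'X; apply: subv_trans.
Qed.

Definition largest_indep S I :=
  [/\ indep I, (I <= S)%VS
    & forall L, indep L -> (L <= S)%VS -> \dim L <= \dim I].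

(** A largest independent subspace [I] of [S], contained in a basis [B0], equals
    [S :&: B0], which is itself independent; so the intersections compared in
    (B4) can be replaced by independent subspaces. *)
Lemma max_in_cap_familyP S I :
  max_in fullv (cap_family S B) I <-> largest_indep S I.
Proof.
split=> [[[B0 BB0 <-] _ maxI]|[[B0 BB0 IB0] IS maxI]].
  split=> [||L [B1 BB1 LB1] LS]; [by exists B0; rewrite ?capvSr | exact: capvSl |].
  apply: leq_trans (maxI (S :&: B1)%VS _ (subvf _)); last by exists B1.
  by rewrite dimvS // subv_cap LS.
have IE : (S :&: B0)%VS = I.
  apply/esym/eqP; rewrite eqEdim subv_cap IS IB0 /= maxI ?capvSl //.
  by exists B0; rewrite ?capvSr.
split; [by exists B0 | exact: subvf |] => _ [B1 BB1 <-] _.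
by apply: maxI; [exists B1; rewrite ?capvSr | apply: capvSl].
Qed.

Lemma largest_indep_add_line S I v :
  largest_indep S I -> v \in S -> v \notin I -> ~ indep (I + <[v]>)%VS.
Proof.
move=> [_ IS maxI] vS vI iIv; have := maxI _ iIv.
by rewrite subv_add IS -memvE vS dim_add_line // ltnn => /(_ isT).
Qed.

Lemma largest_indep_extend S I : indep I -> (I <= S)%VS ->
  exists2 K, largest_indep S K & (I <= K)%VS.
Proof.
have [m] := ubnP (\dim S - \dim I); elim: m I => // m IHm I ltm iI IS.
have [maxI|] := pselect (forall L, indep L -> (L <= S)%VS -> \dim L <= \dim I).
  by exists I.
move=> /existsNP[L /not_implyP[iL /not_implyP[LS /negP]]].
rewrite -ltnNge => ltIL.
have [X [IX /subvPn[v vL vX] hX]] := indep_augment iI iL ltIL.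
have vI : v \notin I by apply: contra vX; apply: subvP.
have [||K maxK IvK] := IHm (I + <[v]>)%VS _ (hX v vX).
- rewrite dim_add_line // -ltnS; apply: leq_trans ltm.
  by rewrite ltnS ltn_sub2l // (leq_trans ltIL) // dimvS.
- by rewrite subv_add IS -memvE (subvP LS).
by exists K => //; apply: subv_trans IvK; apply: addvSl.
Qed.

(** Every vector of [S] extending [K] would contradict maximality, so the
    obstruction [X] to augmenting [K] contains all of [S]. *)
Lemma largest_indep_augment S K L : largest_indep S K -> indep L ->
    \dim K < \dim L ->
  exists X, [/\ (S <= X)%VS, ~~ (L <= X)%VS
              & forall v, v \notin X -> indep (K + <[v]>)%VS].
Proof.
move=> maxK iL ltKL; have [iK _ _] := maxK.
have [X [KX LX hX]] := indep_augment iK iL ltKL.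
exists X; split=> //; apply/subvP => v vS; apply: contraT => vX.
case: (largest_indep_add_line maxK vS _ (hX v vX)).
by apply: contra vX; apply: subvP.
Qed.

Lemma exchange_axiom_B4 : axiom_B4 B.
Proof.
move=> A A' I J /max_in_cap_familyP maxI /max_in_cap_familyP maxJ.
have [[iI IA _] [iJ JA' _]] := (maxI, maxJ).
have [K maxK IK] := largest_indep_extend iI (addvSl I J).
have [K' maxK' JK'] := largest_indep_extend iJ (addvSr I J).
have [iK KS _] := maxK; have [_ K'S _] := maxK'.
have dimKK' : \dim K' <= \dim K.
  by have [_ _] := maxK; apply=> //; have [] := maxK'.
exists K => //; apply/max_in_cap_familyP; split=> // [|L iL LAA'].
  exact: subv_trans KS (addvS IA JA').
rewrite leqNgt; apply/negP => ltKL.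
have [X [SX LX hX]] := largest_indep_augment maxK iL ltKL.
have avoid v U : v \notin X -> (U <= I + J)%VS -> v \notin U.
  by move=> vX US; apply: contra vX; apply/subvP/(subv_trans US).
have : ~~ ((A <= X) && (A' <= X))%VS.
  by rewrite -subv_add; apply: contra LX; apply: subv_trans.
rewrite negb_and => /orP[] /subvPn[v vA vX].
  case: (largest_indep_add_line maxI vA); first exact: avoid (addvSl _ _).
  by apply: indepS (hX v vX); apply: addvS.
have ltK'v : \dim K' < \dim (K + <[v]>).
  by rewrite dim_add_line // (avoid v K vX KS).
have [Y [SY KvY hY]] := largest_indep_augment maxK' (hX v vX) ltK'v.
case: (largest_indep_add_line maxJ vA); first exact: avoid (addvSr _ _).
apply: (@indepS _ (K' + <[v]>)%VS); first exact: addvS.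
apply: hY; apply: contra KvY => vY.
by rewrite subv_add (subv_trans KS SY) -memvE.
Qed.

End Independence.

(** * The basis axioms *)

Theorem theorem30 (F : fieldType) (n : nat) (E : vectType F)
    (B : set {vspace E}) (n_gt0 : 0 < n) (dimE : \dim {:E} = n)
    (B1 : axiom_B1 B) (B2 : axiom_B2 B) (nB3 : axiom_nB3 B) :
  is_qmatroid B.
Proof.
have exB := axiom_nB3_exchange nB3.
by split=> //; [apply: exchange_axiom_B3 | apply: exchange_axiom_B4].
Qed.
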